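(* Let $A$ and $H$ be finite groups with $A$ abelian, such that $H$ acts on $A$. Let $\Gamma$ be an extension of $A$ by $H$ (inducing the given action of $H$ on $A$). Let $S\subset H$ and $B\subset A$ be nonempty, let $\tilde S\subset\Gamma$ be any lifting of the set $S$ to $\Gamma$, and let $\tilde B=\{a^x \mid a\in B,\ x\in H\}$ be the union of the $H$-orbits of the elements of $B$, regarded as a multiset indexed by $B\times H$. Assume that: (1) $H$ is generated by $S$ and has average Kazhdan constant $\epsilon_H>0$ with respect to $S$; (2) $A$ is generated by $\tilde B$ and has average Kazhdan constant $\epsilon_A>0$ with respect to $\tilde B$. Then the group $\Gamma$ has, with respect to the generating set $\tilde S\cup B$, an average Kazhdan constant $\epsilon$ satisfying $$\epsilon>\frac{\epsilon_H\,\epsilon_A}{512\cdot\left(1+\frac{|S|}{|B|}+\frac{|B|}{|S|}\right)}.$$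
   Context: An extension of $A$ by $H$ is a group $\Gamma$ with $A\lhd\Gamma$ and $\Gamma/A\cong H$; since $A$ is abelian, conjugation in $\Gamma$ induces an action of $H$ on $A$, and $a^x$ denotes the image of $a\in A$ under the action of $x\in H$. A lifting $\tilde S$ of $S$ consists of one chosen preimage in $\Gamma$ for each $s\in S$. For a group $G$ and a finite generating multiset $T$ of $G$ (an object like a set except that multiplicity is significant), a number $\epsilon>0$ is called an average Kazhdan constant of $G$ with respect to $T$ if $$\inf_{\rho\in G_0^*}\ \inf_{0\neq v\in\mathcal H_\rho}\ \frac{1}{|T|}\sum_{t\in T}\frac{\|\rho(t)v-v\|^2}{\|v\|^2}\ \ge\ \epsilon,$$ where $G_0^*$ denotes the space of unitary representations $(\rho,\mathcal H_\rho)$ of $G$ with no non-zero invariant vectors. Sums over $T$ and the cardinality $|T|$ count multiplicity. The union $\tilde S\cup B$ is a union of multisets, of cardinality $|S|+|B|$.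
   Formalization: The infimum defining an average Kazhdan constant is taken in [0,4], so constants are at most 4; this matters only for a trivial group, where the infimum over the empty family would be infinite and the claim would fail (for example H = 1, A = Z/2, huge ε_H). *)

(* Defs.v *)
From HB Require Import structures.
From mathcomp Require Import all_boot all_order all_algebra all_fingroup.
From mathcomp Require Import all_classical all_reals all_analysis.
From mathcomp Require Import complex.

Set Implicit Arguments.
Unset Strict Implicit.
Unset Printing Implicit Defensive.

Import Order.TTheory GRing.Theory Num.Theory.
Import numFieldNormedType.Exports.

Local Open Scope classical_set_scope.
Local Open Scope ring_scope.

(* The space is complete for its norm, and [urep_hilbert] says that this norm
   comes from the inner product, so it is a complex Hilbert space of arbitrary
   dimension.  The values of [urep_act] outside [G] are irrelevant. *)
Record unitary_rep (R : realType) (gT : finGroupType) (G : {group gT}) :=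
  UnitaryRep {
    urep_space : completeNormedModType R[i];
    urep_dot : {dot urep_space for Num.conj};
    urep_act : gT -> {linear urep_space -> urep_space};
    urep_hilbert : forall v, `|v| ^+ 2 = urep_dot v v;
    urep_act1 : forall v, urep_act 1%g v = v;
    urep_actM : forall x y v, x \in G -> y \in G ->
      urep_act (x * y)%g v = urep_act x (urep_act y v);
    urep_unitary : forall x u v, x \in G ->
      urep_dot (urep_act x u) (urep_act x v) = urep_dot u v
  }.

Definition no_invariants (R : realType) (gT : finGroupType) (G : {group gT})
    (rho : unitary_rep R G) : Prop :=
  forall v : urep_space rho,
    (forall x, x \in G -> urep_act rho x v = v) -> v = 0.

(* A multiset in a group is a sequence, considered up to permutation.  Norms on
   a complex normed module take their (real) values in [R[i]], hence the
   projection. *)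
Definition avg_displacement (R : realType) (gT : finGroupType) (G : {group gT})
    (T : seq gT) (rho : unitary_rep R G) (v : urep_space rho) : R :=
  complex.Re ((size T)%:R^-1 *
    \sum_(t <- T) (`|urep_act rho t v - v| ^+ 2 / `|v| ^+ 2)).

(* Average displacements lie in [0, 4], and the infimum is taken in this
   interval.  The [min] only matters for the trivial group, whose
   representations without non-zero invariant vectors have no non-zero vector:
   the infimum over the empty family is then 4 instead of +oo. *)
Definition avg_kazhdan_inf (R : realType) (gT : finGroupType) (G : {group gT})
    (T : seq gT) : \bar R :=
  Order.min 4%:E
    (ereal_inf
      [set y | exists2 rho : unitary_rep R G, no_invariants rho &
         y = ereal_inf [set (avg_displacement T v)%:E
                          | v in [set v : urep_space rho | v != 0]]]).

Definition avg_kazhdan_constant (R : realType) (gT : finGroupType)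
    (G : {group gT}) (T : seq gT) (eps : R) : Prop :=
  [/\ <<[set t in T]>>%g = G :> {set gT},
      0 < eps
    & (eps%:E <= avg_kazhdan_inf R G T)%E].

(* [Gam] is an extension of [A] by [H]; [phi] identifies [Gam / A] with [H], and
   the conjugation action of [H] on [A] induced through [phi] is [to]. *)
Definition group_extension (gT hT : finGroupType) (Gam A : {group gT})
    (H : {group hT}) (phi : {morphism (Gam / A)%g >-> hT})
    (to : groupAction H A) : Prop :=
  [/\ normal A Gam,
      isom (Gam / A)%g H phi
    & forall a g, a \in A -> g \in Gam -> to a (phi (coset A g)) = (a ^ g)%g].

Definition is_lifting (gT hT : finGroupType) (Gam A : {group gT})
    (phi : {morphism (Gam / A)%g >-> hT}) (S : {set hT})
    (lift : hT -> gT) : Prop :=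
  forall s, s \in S -> lift s \in Gam /\ phi (coset A (lift s)) = s.

Definition lifting_multiset (gT hT : finGroupType) (S : {set hT})
    (lift : hT -> gT) : seq gT :=
  [seq lift s | s <- enum S].

Definition orbit_multiset (gT hT : finGroupType) (A : {group gT})
    (H : {group hT}) (to : groupAction H A) (B : {set gT}) : seq gT :=
  [seq to a x | a <- enum B, x <- enum H].

(* Main.v *)
(* The regular representation on mean-zero functions turns an average Kazhdan
   constant of a finite group into a Poincare inequality for scalar functions on
   it, hence for functions with values in an inner product space.

   Decompose a representation of [Gam] into its isotypic components under the
   abelian group [A]; [Gam] permutes them through the action of [H] on the
   characters of [A].  On the [A]-fixed vectors [H] acts without invariants, so
   the gap of [H] applies.  For the other components only the norms
   [f k = |v_k|] matter.  The Poincare inequality of [H] makes [f] close, in l2,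
   to its average [m] over [H]-orbits of characters; since [m] is [H]-invariant,
   averaging over [B] weighted by [m ^+ 2] is the same as averaging over the
   orbits of [B], and the gap of [A] at each nontrivial character bounds [m] by
   the displacement of [v] under [B].  Summing up gives the constant 48 in place
   of 512. *)
Require Import Defs.
From HB Require Import structures.
From mathcomp Require Import all_boot all_order all_algebra all_fingroup.
From mathcomp Require Import all_classical all_reals all_analysis.
From mathcomp Require Import all_solvable all_field all_character.
From mathcomp Require Import complex.
From mathcomp Require Import ring lra.

Set Implicit Arguments.
Unset Strict Implicit.
Unset Printing Implicit Defensive.

Import Order.TTheory GRing.Theory Num.Theory.
Import numFieldNormedType.Exports.

Local Open Scope ring_scope.

(** * Squared moduli and finite sums of squares *)

Definition nsq (R : realType) (z : R[i]) : R :=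
  complex.Re z ^+ 2 + complex.Im z ^+ 2.

Lemma nsq_ge0 (R : realType) (z : R[i]) : 0 <= nsq z.
Proof. by rewrite addr_ge0 ?sqr_ge0. Qed.

Lemma nsqE (R : realType) (z : R[i]) : (nsq z)%:C%C = `|z| ^+ 2.
Proof. by rewrite -add_Re2_Im2. Qed.

(** The expansion of the sum of the squares of [q * b i - p * a i] is [q * (q * r - p ^+ 2)].
    Dividing by [q] fails only if [q = 0], and then every [a i] vanishes. *)
Lemma cauchy_schwarz_sum (R : realFieldType) (I : finType) (a b : I -> R) :
  (\sum_i a i * b i) ^+ 2 <= (\sum_i a i ^+ 2) * (\sum_i b i ^+ 2).
Proof.
set p := \sum_i _; set q := \sum_i a i ^+ 2; set r := \sum_i b i ^+ 2.
have q0 : 0 <= q by apply: sumr_ge0 => i _; exact: sqr_ge0.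
have key : 0 <= q * (q * r - p ^+ 2).
  have -> : q * (q * r - p ^+ 2) = \sum_i (q * b i - p * a i) ^+ 2.
    rewrite (eq_bigr (fun i => q ^+ 2 * b i ^+ 2 - 2 * q * p * (a i * b i) +
       p ^+ 2 * a i ^+ 2)); last by move=> i _ /=; ring.
    rewrite big_split sumrB -!mulr_sumr /= -/p -/q -/r; ring.
  by apply: sumr_ge0 => i _; exact: sqr_ge0.
have [q00|qn0] := eqVneq q 0.
  have a0 i : a i = 0.
    have /psumr_eq0P := q00; move/(_ (fun i _ => sqr_ge0 (a i))) => /(_ i isT).
    by move/eqP; rewrite sqrf_eq0 => /eqP.
  rewrite /p big1 ?expr0n ?q00 ?mul0r // => i _; by rewrite a0 mul0r.
have qp : 0 < q by rewrite lt0r qn0.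
by move: key; rewrite pmulr_rge0 // subr_ge0.
Qed.

Lemma minkowski_sum (R : rcfType) (I : finType) (a b : I -> R) :
  Num.sqrt (\sum_i (a i + b i) ^+ 2) <=
  Num.sqrt (\sum_i a i ^+ 2) + Num.sqrt (\sum_i b i ^+ 2).
Proof.
have a0 : 0 <= \sum_i a i ^+ 2 by apply: sumr_ge0 => i _; exact: sqr_ge0.
have b0 : 0 <= \sum_i b i ^+ 2 by apply: sumr_ge0 => i _; exact: sqr_ge0.
rewrite -[leRHS]ger0_norm ?addr_ge0 ?sqrtr_ge0 // -sqrtr_sqr.
rewrite ler_sqrt ?sqr_ge0 // sqrrD !sqr_sqrtr // -sqrtrM //.
rewrite (eq_bigr (fun i => a i ^+ 2 + (a i * b i) *+ 2 + b i ^+ 2)); last first.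
  by move=> i _; rewrite sqrrD.
rewrite !big_split /= lerD2r lerD2l. rewrite -mulr2n lerMn2r /=.
apply: le_trans (ler_norm _) _.
by rewrite -sqrtr_sqr ler_wsqrtr // cauchy_schwarz_sum.
Qed.

(** * The regular representation on mean-zero functions *)

Section MeanZero.
Variables (R : realType) (K : finGroupType).

(** This is the orthogonal complement of the constants, which are the invariant vectors of the
    regular representation. *)
Definition mean_zero : {pred {ffun K -> R[i]}} :=
  fun f => \sum_x f x == 0.

Lemma mean_zero_submod : submod_closed mean_zero.
Proof.
split=> [|a f g]; rewrite !unfold_in.
  by rewrite big1 // => x _; rewrite ffunE.
move=> /eqP f0 /eqP g0; rewrite (eq_bigr (fun x => a * f x + g x)).
  by rewrite big_split -mulr_sumr f0 g0 /= mulr0 addr0.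
by move=> x _; rewrite !ffunE.
Qed.
HB.instance Definition _ :=
  GRing.isSubmodClosed.Build R[i] {ffun K -> R[i]} mean_zero mean_zero_submod.

Record mzfun := MzFun { mzval :> {ffun K -> R[i]}; _ : mzval \in mean_zero }.
HB.instance Definition _ := [isSub for mzval].
HB.instance Definition _ := [Choice of mzfun by <:].
HB.instance Definition _ := [SubChoice_isSubLmodule of mzfun by <:].

Lemma mzfun_sum (f : mzfun) : \sum_x f x = 0.
Proof. by case: f => f /= /eqP. Qed.

Definition sqn (f : mzfun) : R := \sum_x nsq (f x).

Definition mznorm (f : mzfun) : R[i] := (Num.sqrt (sqn f))%:C%C.

Lemma sqn_ge0 f : 0 <= sqn f.
Proof. by apply: sumr_ge0 => i _; exact: nsq_ge0. Qed.

Lemma nsq_le_sqn (f : mzfun) x : nsq (f x) <= sqn f.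
Proof.
rewrite /sqn (bigD1 x) //= lerDl; apply: sumr_ge0 => i _; exact: nsq_ge0.
Qed.

Lemma sqn_eq0 (f : mzfun) : sqn f = 0 -> f = 0.
Proof.
move=> f0; apply/val_inj/ffunP => x; rewrite [RHS]ffunE.
have := nsq_le_sqn f x; rewrite f0 => h.
have {h} : nsq (f x) = 0 by apply/eqP; rewrite eq_le h nsq_ge0.
move=> /(congr1 (fun r => r%:C%C)); rewrite nsqE => /eqP.
by rewrite sqrf_eq0 normr_eq0 => /eqP.
Qed.

Lemma mznormD f g : mznorm (f + g) <= mznorm f + mznorm g.
Proof.
have nsqN (z : R[i]) : nsq z = ComplexField.Normc.normc z ^+ 2.
  by case: z => a b; rewrite sqr_sqrtr // addr_ge0 ?sqr_ge0.
rewrite /mznorm -rmorphD lecR /sqn.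
under [X in Num.sqrt X <= _]eq_bigr do rewrite nsqN.
under [X in _ <= Num.sqrt X + _]eq_bigr do rewrite nsqN.
under [X in _ <= _ + Num.sqrt X]eq_bigr do rewrite nsqN.
apply: le_trans (minkowski_sum _ _).
apply: ler_wsqrtr; apply: ler_sum => x _; rewrite ffunE.
have n0 (z : R[i]) : 0 <= ComplexField.Normc.normc z by case: z => a b; exact: sqrtr_ge0.
by rewrite lerXn2r ?nnegrE ?addr_ge0 //; exact: le_normcD.
Qed.

Lemma mznormZ (l : R[i]) f : mznorm (l *: f) = `|l| * mznorm f.
Proof.
have sqnZ : sqn (l *: f) = nsq l * sqn f.
  rewrite /sqn mulr_sumr; apply: eq_bigr => x _; rewrite ffunE.
  case: l => a b; case: ((f : {ffun _ -> _}) x) => c d.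
  by rewrite /nsq /=; ring.
by rewrite normc_def /mznorm -rmorphM sqnZ sqrtrM ?nsq_ge0.
Qed.

Lemma mznorm_eq0 f : mznorm f = 0 -> f = 0.
Proof.
move=> /complexI /eqP; rewrite sqrtr_eq0 => h.
by apply: sqn_eq0; apply/eqP; rewrite eq_le h sqn_ge0.
Qed.

HB.instance Definition _ :=
  Lmodule_isNormed.Build R[i] mzfun mznormD mznormZ mznorm_eq0.

Local Open Scope classical_set_scope.


(** Convergence is checked on the finitely many real and imaginary coordinates, each dominated by
    the norm. The limit keeps mean zero, and the squared distance to it is a finite sum of terms
    tending to 0. *)
Lemma mzfun_complete (F : set_system mzfun) :
  ProperFilter F -> cauchy F -> cvg F.
Proof.
move=> FF /cauchy_ballP Fc.
have coord (p : mzfun -> R) : (forall f g, p (f - g) = p f - p g) ->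
    (forall f, p f ^+ 2 <= sqn f) -> cvg (p @ F).
  move=> pB pS; apply: cauchy_cvg; apply/cauchy_ballP => e e0.
  have e0' : 0 < e%:C%C :> R[i] by rewrite ltcR.
  rewrite near_map2; apply: filterS (Fc _ e0') => -[f g].
  rewrite -!ball_normE /= ltcR.
  apply: le_lt_trans; rewrite -pB -sqrtr_sqr; exact: ler_wsqrtr.
have cR x : cvg ((fun f : mzfun => complex.Re (f x)) @ F).
  apply: coord => [f g|f]; first by rewrite !ffunE raddfB.
  by apply: le_trans (nsq_le_sqn f x); rewrite lerDl sqr_ge0.
have cI x : cvg ((fun f : mzfun => complex.Im (f x)) @ F).
  apply: coord => [f g|f]; first by rewrite !ffunE raddfB.
  by apply: le_trans (nsq_le_sqn f x); rewrite lerDr sqr_ge0.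
pose lR x := lim ((fun f : mzfun => complex.Re (f x)) @ F).
pose lI x := lim ((fun f : mzfun => complex.Im (f x)) @ F).
have sum0 (c : R[i] -> R) (l : K -> R) : {morph c : u v / u + v} ->
    (forall x, (fun f : mzfun => c (f x)) @ F --> l x) -> \sum_x l x = 0.
  move=> cD cl.
  have c0 : c 0 = 0 by apply: (addrI (c 0)); rewrite -cD !addr0.
  have h1 : (fun f : mzfun => \sum_x c (f x)) @ F --> \sum_x l x.
    by apply: cvg_big => //; exact: add_continuous.
  have h2 : (fun f : mzfun => \sum_x c (f x)) @ F --> (0 : R).
    rewrite (_ : (fun f : mzfun => _) = fun=> 0); first exact: cvg_cst.
    by apply/funext => f; rewrite -(big_morph c cD c0) mzfun_sum.
  exact: (cvg_unique _ h1 h2).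
have lR0 : \sum_x lR x = 0.
  by apply: (sum0 (@complex.Re R)) => [u v|x]; [rewrite raddfD|exact: cR].
have lI0 : \sum_x lI x = 0.
  by apply: (sum0 (@complex.Im R)) => [u v|x]; [rewrite raddfD|exact: cI].
have l0 : [ffun x => lR x +i* lI x]%C \in mean_zero.
  rewrite unfold_in (eq_bigr (fun x => (lR x)%:C%C + 'i%C * (lI x)%:C%C)); last first.
    by move=> x _; rewrite ffunE [LHS]complexE.
  by rewrite big_split /= -mulr_sumr -!rmorph_sum /= lR0 lI0 mulr0 addr0.
apply/cvg_ex; exists (MzFun l0).
apply/cvgrPdist_lt => e e0.
(* The order of [R[i]] is partial: a positive element has zero imaginary part. *)
have [r r0 ->] : exists2 r : R, 0 < r & e = r%:C%C.
  exists (complex.Re e).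
    by move: e0; rewrite ltcE /= => /andP[].
  by move: e0; rewrite ltcE /= => /andP[/eqP e1 _]; case: e e1 => a b /= ->.
have cs : (fun f : mzfun => sqn (MzFun l0 - f)) @ F --> (0 : R).
  rewrite (_ : 0 = \sum_(x : K) (0 : R)); last by rewrite big1.
  apply: cvg_big => [|x _]; first exact: add_continuous.
  rewrite (_ : (fun f => _) = fun f : mzfun =>
    (lR x - complex.Re (f x)) * (lR x - complex.Re (f x)) +
    (lI x - complex.Im (f x)) * (lI x - complex.Im (f x))); last first.
    apply/funext => f; rewrite !ffunE /nsq !expr2.
    by case: ((f : {ffun _ -> _}) x).
  rewrite (_ : 0 = (lR x - lR x) * (lR x - lR x) +
    (lI x - lI x) * (lI x - lI x)); last by rewrite !subrr mulr0 addr0.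
  apply: cvgD; (apply: cvgM; (apply: cvgB; [exact: cvg_cst|])).
  - exact: cR. - exact: cR. - exact: cI. - exact: cI.
apply: filterS (cvgr_lt _ cs _ (exprn_gt0 2 r0)) => f /= h.
 rewrite ltcR -(ltr_pXn2r (_ : 0 < 2)%N) ?nnegrE ?sqrtr_ge0 ?ltW //.
by rewrite sqr_sqrtr ?sqn_ge0.
Qed.
HB.instance Definition _ := Uniform_isComplete.Build mzfun mzfun_complete.

Definition mzdot (f g : mzfun) : R[i] := \sum_x f x * (g x)^*.

Lemma mzdot_bilinear :
  bilinear_for (GRing.Scale.Law.clone _ _ *%R _)
    (GRing.Scale.Law.clone _ _ (Num.conj \; *%R) _) mzdot.
Proof.
split=> [g a f1 f2|f a g1 g2]; rewrite /mzdot /= mulr_sumr -big_split /=.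
  by apply: eq_bigr => x _; rewrite !ffunE mulrDl mulrA.
apply: eq_bigr => x _; rewrite !ffunE rmorphD rmorphM mulrDr /=.
by rewrite !mulrA [f x * _]mulrC.
Qed.
HB.instance Definition _ := bilinear_isBilinear.Build R[i] mzfun mzfun R[i]
  (GRing.Scale.Law.clone _ _ *%R _)
    (GRing.Scale.Law.clone _ _ (Num.conj \; *%R) _) mzdot mzdot_bilinear.

Lemma mzdot_herm f g : mzdot f g = (-1) ^+ false * Num.conj (mzdot g f).
Proof.
rewrite mul1r /mzdot rmorph_sum; apply: eq_bigr => x _.
by rewrite rmorphM /= conjCK mulrC.
Qed.
HB.instance Definition _ :=
  isHermitianSesquilinear.Build R[i] mzfun false Num.conj mzdot mzdot_herm.

Lemma mzdotE f : mzdot f f = (sqn f)%:C%C.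
Proof.
rewrite /mzdot /sqn rmorph_sum; apply: eq_bigr => x _ /=.
by rewrite nsqE normCK.
Qed.

Lemma mzdot_gt0 f : f != 0 -> 0 < mzdot f f.
Proof.
move=> f0; rewrite mzdotE ltcR lt0r sqn_ge0 andbT.
by apply: contraNneq f0 => /sqn_eq0 ->.
Qed.
HB.instance Definition _ := isDotProduct.Build R[i] mzfun mzdot mzdot_gt0.


End MeanZero.

Section MeanZeroRep.
Variables (R : realType) (gT : finGroupType) (G : {group gT}).
Local Notation K := (subg_of G).
Local Notation W := (mzfun R K).

Fact mzact_subproof (k : K) (f : W) : [ffun y => f (y * k)%g] \in @mean_zero R K.
Proof.
rewrite unfold_in; under eq_bigr do rewrite ffunE.
by rewrite -(reindex_inj (mulIg k) (P := predT) (F := fun y => f y)) mzfun_sum.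
Qed.
Definition mzact k (f : W) : W := MzFun (mzact_subproof k f).

Lemma mzactE k f y : mzact k f y = f (y * k)%g.
Proof. by rewrite ffunE. Qed.

Lemma mzact_linear k : linear (mzact k).
Proof. by move=> a f g; apply/val_inj/ffunP => y; rewrite !ffunE. Qed.
HB.instance Definition _ k :=
  GRing.isLinear.Build R[i] W W *:%R (mzact k) (mzact_linear k).

Lemma mzact_unitary k f g : mzdot (mzact k f) (mzact k g) = mzdot f g.
Proof.
rewrite /mzdot; under eq_bigr do rewrite !mzactE.
by rewrite -(reindex_inj (mulIg k) (P := predT) (F := fun y => f y * (g y)^*)).
Qed.

Lemma mzfun_hilbert (f : W) : `|f| ^+ 2 = mzdot f f.
Proof. by rewrite mzdotE -rmorphXn /= sqr_sqrtr ?sqn_ge0. Qed.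

(** The group acts by right translation; [subg G] sends elements outside [G] to 1, which makes the
    action total. The definition is transparent so that later proofs can compute with the action. *)
Definition mean_zero_rep : unitary_rep R G.
Proof.
refine (@UnitaryRep R gT G W (@mzdot R K) (fun x => mzact (subg G x))
  mzfun_hilbert _ _ _).
- by move=> f; apply/val_inj/ffunP => y; rewrite ffunE morph1 mulg1.
- move=> x y f xG yG; apply/val_inj/ffunP => z.
  by rewrite !ffunE morphM // mulgA.
- by move=> x f g _; exact: mzact_unitary.
Defined.

(** A translation-invariant function is constant, and a constant of mean zero vanishes. *)
Lemma mean_zero_rep_no_invariants : no_invariants mean_zero_rep.
Proof.
move=> /= f finv; apply/val_inj/ffunP => y; rewrite [RHS]ffunE.
have fc k : f k = f 1%g.
  have := finv (sgval k) (subgP k); rewrite sgvalK => /(congr1 (fun h : W => h 1%g)).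
  by rewrite mzactE mul1g.
have := mzfun_sum f.
rewrite (eq_bigr (fun=> f 1%g)) => [|k _]; last exact: fc.
rewrite sumr_const fc -mulr_natr => /eqP; rewrite mulf_eq0 pnatr_eq0 => /orP[/eqP//|].
by rewrite (cardD1 1%g).
Qed.

End MeanZeroRep.

(** * Real-valued squared norms and displacements in a representation *)

Section Rep.
Variables (R : realType) (gT : finGroupType) (G : {group gT}).
Variable rho : unitary_rep R G.
Local Notation V := (urep_space rho).
Local Notation act := (urep_act rho).

Definition usq (v : V) : R := complex.Re (`|v| ^+ 2).

Lemma usqE v : `|v| ^+ 2 = (usq v)%:C%C.
Proof. by rewrite RRe_real // realX // normr_real. Qed.

Lemma usq_ge0 v : 0 <= usq v.
Proof. by rewrite -ler0c -usqE exprn_ge0. Qed.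

Lemma usq_gt0 v : (0 < usq v) = (v != 0).
Proof. by rewrite -ltcR -usqE lt0r sqrf_eq0 normr_eq0 exprn_ge0 ?andbT. Qed.

Lemma avg_displacementE T (v : V) :
  avg_displacement T v = (size T)%:R^-1 * \sum_(t <- T) usq (act t v - v) / usq v.
Proof.
rewrite /avg_displacement.
rewrite -[RHS]/(complex.Re
  (((size T)%:R^-1 * \sum_(t <- T) usq (act t v - v) / usq v)%:C%C)).
congr complex.Re; rewrite rmorphM fmorphV rmorph_nat rmorph_sum; congr *%R.
by apply: eq_bigr => t _; rewrite !usqE fmorph_div.
Qed.

End Rep.

(** * Poincare inequalities *)

Section Poincare.
Variables (R : realType) (gT : finGroupType) (G : {group gT}).
Variables (T : seq gT) (eps : R).
Hypothesis kG : avg_kazhdan_constant G T eps.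

Lemma kazhdan_sub t : t \in T -> t \in G.
Proof. by case: kG => <- _ _ tT; rewrite mem_gen // inE. Qed.

Lemma kazhdan_gt0 : 0 < eps. Proof. by case: kG. Qed.

Lemma kazhdan_le4 : eps <= 4.
Proof. by case: kG => _ _; rewrite le_min => /andP[]; rewrite lee_fin. Qed.

Lemma kazhdan_displacement (rho : unitary_rep R G) v :
  no_invariants rho -> v != 0 -> eps <= avg_displacement T (v : urep_space rho).
Proof.
move=> rho0 v0; rewrite -lee_fin; case: kG => _ _ /le_trans -> //.
rewrite ge_min; apply/orP; right; apply: le_trans (ereal_inf_lbound _) _.
  by exists rho.
by apply: ereal_inf_lbound; exists v.
Qed.

Lemma big_subg_of (F : gT -> R) : \sum_(x : subg_of G) F (sgval x) = \sum_(x in G) F x.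
Proof.
rewrite (reindex_onto (@sgval gT G) (subg G)) /=; last by move=> x xG; rewrite subgK.
by apply: eq_bigl => x; rewrite subgP sgvalK eqxx.
Qed.

(** Seen as a vector of [mean_zero_rep], [f] is displaced by [t] to the difference
    [f (x * t) - f x], so the Kazhdan constant applies directly. *)
Lemma kazhdan_poincare (f : gT -> R) : \sum_(x in G) f x = 0 ->
  eps * (size T)%:R * \sum_(x in G) f x ^+ 2 <=
  \sum_(t <- T) \sum_(x in G) (f (x * t)%g - f x) ^+ 2.
Proof.
move=> f0.
have g0 : [ffun y : subg_of G => (f (sgval y))%:C%C] \in @mean_zero R (subg_of G).
  rewrite unfold_in; under eq_bigr do rewrite ffunE.
  by rewrite -rmorph_sum /= big_subg_of f0.
pose g := MzFun g0.
have sg (h : mzfun R (subg_of G)) (p : gT -> R) : (forall y, h y = (p (sgval y))%:C%C) ->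
    @usq R gT G (mean_zero_rep R G) h = \sum_(x in G) p x ^+ 2.
  move=> hp; rewrite /usq urep_hilbert /= mzdotE /= -big_subg_of.
  by apply: eq_bigr => y _; rewrite hp /nsq /= expr0n addr0.
have sgg := sg g f (fun y => ffunE _ _).
have [gz|gn0] := eqVneq g 0.
  move: sgg; rewrite gz /usq normr0 expr0n /= => <-; rewrite mulr0.
  by apply: sumr_ge0 => t _; apply: sumr_ge0 => x _; exact: sqr_ge0.
have := @kazhdan_displacement (mean_zero_rep R G) g
  (@mean_zero_rep_no_invariants _ _ _) gn0.
rewrite avg_displacementE -mulr_suml sgg mulrA.
have q0 : 0 < \sum_(x in G) f x ^+ 2 by rewrite -sgg usq_gt0.
rewrite ler_pdivlMr // => h.
have -> : \sum_(t <- T) \sum_(x in G) (f (x * t)%g - f x) ^+ 2 =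
  \sum_(t <- T) usq (urep_act (mean_zero_rep R G) t g - g).
  rewrite !big_seq; apply: eq_bigr => t tT; apply/esym/sg => y.
  by rewrite !ffunE /= -rmorphB subgK ?kazhdan_sub.
(* For empty [T] the factor [(size T)%:R^-1] is 0 and cannot be cleared, but both sides vanish. *)
case: (posnP (size T)) => [/size0nil ->|s0]; first by rewrite !big_nil mulr0 mul0r.
by move: h; rewrite mulrC ler_pdivlMl ?ltr0n // => h; rewrite -mulrA mulrC -mulrA.
Qed.

End Poincare.

(** * The real inner product underlying the Hermitian one *)

Section RealInnerProduct.
Variables (R : realType) (gT : finGroupType) (G : {group gT}).
Variable rho : unitary_rep R G.
Local Notation V := (urep_space rho).

Definition rdot (u v : V) : R := complex.Re (urep_dot rho u v).

Lemma usq_rdot v : usq v = rdot v v.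
Proof. by rewrite /usq urep_hilbert. Qed.

Lemma rdotDl u v w : rdot (u + v) w = rdot u w + rdot v w.
Proof. by rewrite /rdot linearDl raddfD. Qed.

Lemma rdotBl u v w : rdot (u - v) w = rdot u w - rdot v w.
Proof. by rewrite /rdot linearBl raddfB. Qed.

Lemma rdotZl (r : R) u v : rdot (r%:C%C *: u) v = r * rdot u v.
Proof.
rewrite /rdot linearZl_LR /=; case: (urep_dot rho u v) => a b /=.
by rewrite mul0r subr0.
Qed.

Lemma rdotC u v : rdot u v = rdot v u.
Proof.
have ReJ (z : R[i]) : complex.Re z^* = complex.Re z by case: z.
by rewrite /rdot (hermC (urep_dot rho) u v) expr0 mul1r; exact: ReJ.
Qed.

Lemma rdotZr (r : R) u v : rdot u (r%:C%C *: v) = r * rdot u v.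
Proof. by rewrite rdotC rdotZl rdotC. Qed.

Lemma rdotDr u v w : rdot u (v + w) = rdot u v + rdot u w.
Proof. by rewrite rdotC rdotDl (rdotC v) (rdotC w). Qed.

Lemma usqD_orth u v : rdot u v = 0 -> usq (u + v) = usq u + usq v.
Proof.
by move=> h; rewrite !usq_rdot rdotDl !rdotDr (rdotC v u) h addr0 add0r.
Qed.

Lemma usq0 : usq (rho := rho) 0 = 0.
Proof. by rewrite /usq normr0 expr0n. Qed.

Lemma usqZ (a : R[i]) v : usq (rho := rho) (a *: v) = nsq a * usq v.
Proof.
by apply: complexI; rewrite -usqE rmorphM /= nsqE -usqE normrZ exprMn.
Qed.

Lemma usq_act x u : x \in G -> usq (urep_act rho x u) = usq u.
Proof. by move=> xG; rewrite /usq !urep_hilbert urep_unitary. Qed.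

End RealInnerProduct.

(* A quadratic inequality on scalar functions passes to vectors one
   orthogonal coordinate at a time: split off the component of [F] along one of
   its values, which leaves a function with fewer non-zero values. *)
Lemma kazhdan_poincare_vect (R : realType) (hT : finGroupType) (H : {group hT})
    (T : seq hT) (eps : R) (kH : avg_kazhdan_constant H T eps)
    (gT : finGroupType) (G : {group gT}) (rho : unitary_rep R G)
    (F : hT -> urep_space rho) : \sum_(x in H) F x = 0 ->
  eps * (size T)%:R * \sum_(x in H) usq (F x) <=
  \sum_(t <- T) \sum_(x in H) usq (F (x * t)%g - F x).
Proof.
have [n] := ubnP #|[set x in H | F x != 0]|.
elim: n F => // n IH F; rewrite ltnS => Fn F0.
have [x0 /andP[x0H e0]|Fz] := pickP [pred x in H | F x != 0]; last first.
  rewrite big1 => [|x xH]; last first.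
    by have := Fz x; rewrite /= xH /= => /negbFE/eqP ->; rewrite usq0.
  by rewrite mulr0; apply: sumr_ge0 => t _; apply: sumr_ge0 => x _; exact: usq_ge0.
set e := F x0 in e0; have q0 : 0 < usq e by rewrite usq_gt0.
pose c x := rdot (F x) e / usq e.
pose F' x := F x - (c x)%:C%C *: e.
have orth x : rdot (F' x) e = 0.
  by rewrite /F' rdotBl rdotZl -usq_rdot divfK ?subrr ?gt_eqF.
have FE x : F x = F' x + (c x)%:C%C *: e by rewrite subrK.
have c0 : \sum_(x in H) c x = 0.
  rewrite -mulr_suml /rdot -raddf_sum -linear_sumlz F0.
  by rewrite linear0l mul0r.
have F'0 : \sum_(x in H) F' x = 0.
  by rewrite sumrB F0 -scaler_suml -rmorph_sum /= c0 scale0r subr0.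
(* Removing the component along [e = F x0] creates no new non-zero value and kills the value at
   [x0]. *)
have F'n : (#|[set x in H | F' x != 0%R]| < n)%N.
  apply: leq_trans Fn; apply: proper_card; apply/properP; split.
    apply/fintype.subsetP => x; rewrite !inE => /andP[-> /=].
    apply: contra_neq => Fx; rewrite /F' /c Fx /rdot linear0l /= mul0r.
    by rewrite scale0r subr0.
  exists x0; rewrite !inE x0H //= negbK subr_eq0 -/e /c -/e -usq_rdot.
  by rewrite divff ?scale1r ?gt_eqF.
clearbody F'.
have usqF x : usq (F x) = usq (F' x) + c x ^+ 2 * usq e.
  rewrite FE usqD_orth ?usqZ; last by rewrite rdotZr orth mulr0.
  by rewrite /nsq /= expr0n addr0.
have usqFB x y : usq (F x - F y) = usq (F' x - F' y) + (c x - c y) ^+ 2 * usq e.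
  rewrite [F x]FE [F y]FE opprD addrACA -scalerBl.
  have -> : (c x)%:C%C - (c y)%:C%C = (c x - c y)%:C%C :> R[i] by rewrite rmorphB.
  rewrite (@usqD_orth _ _ _ _ (F' x - F' y)) ?usqZ; last first.
    by rewrite rdotZr rdotBl !orth subrr mulr0.
  by rewrite /nsq /= expr0n addr0.
under eq_bigr do rewrite usqF.
under [X in _ <= X]eq_bigr do under eq_bigr do rewrite usqFB.
under [X in _ <= X]eq_bigr do rewrite big_split /= -mulr_suml.
(* By Pythagoras both sides split: induction handles [F'], and the scalar inequality handles the
   coordinate [c]. *)
rewrite !big_split /= -!mulr_suml mulrDr lerD //; first exact: IH.
by rewrite mulrA ler_wpM2r ?usq_ge0 //; exact: (kazhdan_poincare kH c0).
Qed.

(** * Characters of a finite abelian group *)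

(** In characteristic zero ['X^n - 1] splits with [n] distinct roots, and [n] distinct [n]-th roots
    of unity in a field include a primitive one. *)
Lemma prim_root_exists_closed (C : numClosedFieldType) n :
  (n > 0)%N -> exists z : C, n.-primitive_root z.
Proof.
pose p : {poly C} := 'X^n - 1; have [r Dp] := closed_field_poly_normal p.
move=> n_gt0; rewrite (monicP _) ?monicXnsubC // scale1r in Dp.
have rn1: all n.-unity_root r by apply/allP=> z; rewrite -root_prod_XsubC -Dp.
have sz_r: (n < (size r).+1)%N.
  by rewrite -(size_prod_XsubC r id) -Dp size_XnsubC.
have [|z] := hasP (has_prim_root n_gt0 rn1 _ sz_r); last by exists z.
by rewrite -separable_prod_XsubC -Dp separable_Xn_sub_1 // pnatr_eq0 -lt0n.
Qed.

Section Dual.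
Variables (gT : finGroupType) (A : {group gT}).
Local Notation n := #|A|.-1.
Local Notation T := {ffun gT -> 'I_n.+1}.
Implicit Types k l : T.

(* A character of [A] is encoded by its exponents with respect to a fixed
   primitive [#|A|]-th root of unity, so that the dual group is finite. *)
Definition dual : {set T} :=
  [set k : T | [forall a in A, forall b in A, k (a * b)%g == k a + k b] &&
               [forall a, (a \notin A) ==> (k a == 0)]].

Lemma dualP k : reflect
  ((forall a b, a \in A -> b \in A -> k (a * b)%g = k a + k b) /\
   (forall a, a \notin A -> k a = 0)) (k \in dual).
Proof.
rewrite inE; apply: (iffP andP) => -[h1 h2]; split.
- by move=> a b aA bA; apply/eqP; move/forall_inP/(_ a aA)/forall_inP/(_ b bA) : h1.
- by move=> a aA; apply/eqP; move/forallP/(_ a)/implyP/(_ aA) : h2.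
- by apply/forall_inP => a aA; apply/forall_inP => b bA; rewrite h1.
- by apply/forallP => a; apply/implyP => /h2 ->.
Qed.

Lemma dualM k a b : k \in dual -> a \in A -> b \in A -> k (a * b)%g = k a + k b.
Proof. by move=> /dualP[+ _]; apply. Qed.

Lemma dual_out k a : k \in dual -> a \notin A -> k a = 0.
Proof. by move=> /dualP[_]; apply. Qed.

Lemma dual1 k : k \in dual -> k 1%g = 0.
Proof.
by move=> kD; apply: (addrI (k 1%g)); rewrite -dualM // mulg1 addr0.
Qed.

Lemma dual0 : (0 : T) \in dual.
Proof. by apply/dualP; split => *; rewrite !ffunE ?addr0. Qed.

Lemma dualD k l : k \in dual -> l \in dual -> k + l \in dual.
Proof.
move=> kD lD; apply/dualP; split => [a b aA bA|a aA]; rewrite !ffunE.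
  by rewrite !dualM // addrACA.
by rewrite !dual_out // addr0.
Qed.

Lemma dualN k : k \in dual -> - k \in dual.
Proof.
move=> kD; apply/dualP; split => [a b aA bA|a aA]; rewrite !ffunE.
  by rewrite !dualM // opprD.
by rewrite !dual_out // oppr0.
Qed.

Lemma card_predS : n.+1 = #|A|. Proof. by rewrite prednK // cardG_gt0. Qed.

Lemma prim_expr_ord_inj (F : fieldType) (z : F) (i j : 'I_n.+1) :
  #|A|.-primitive_root z -> z ^+ i = z ^+ j -> i = j.
Proof.
have lt (l : 'I_n.+1) : (l < #|A|)%N by rewrite -[X in (_ < X)%N]card_predS.
move=> zP /eqP; rewrite (eq_prim_root_expr zP) !modn_small // => /eqP.
exact: val_inj.
Qed.

Lemma prim_expr_ordD (F : fieldType) (z : F) (i j : 'I_n.+1) :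
  #|A|.-primitive_root z -> z ^+ (i + j)%R = z ^+ i * z ^+ j.
Proof.
move=> zP; have -> : (i + j)%R = ((i + j) %% #|A|)%N :> nat.
  by rewrite -[X in (_ %% X)%N]card_predS.
by rewrite expr_mod ?exprD // prim_expr_order.
Qed.

(** The irreducible characters of an abelian group are linear and their kernels meet trivially, so
    one of them is not 1 at [a]. Its logarithm to the base of a primitive root in [algC] is the
    required [k]; exponents do not depend on the field, so [k] also serves for [R[i]]. *)
Lemma dual_separates a : abelian A -> a \in A -> a != 1%g ->
  exists2 k, k \in dual & k a != 0.
Proof.
move=> hA aA a1.
have [i ia] : exists i : Iirr A, 'chi_i a != 1.
  apply/existsP; apply: contraNT a1; rewrite negb_exists => /forallP h.
  suff : a \in (\bigcap_i cfker 'chi[A]_i)%g by rewrite TI_cfker_irr inE.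
  apply/finset.bigcapP => i _; rewrite cfkerEirr inE.
  by rewrite lin_char1 ?(negbNE (h i)) //; exact: (char_abelianP _ hA).
have chiL : 'chi_i \is a linear_char by exact: (char_abelianP _ hA).
have [z zP] := C_prim_root_exists (cardG_gt0 A).
have logE b : b \in A -> exists j : 'I_n.+1, 'chi_i b == z ^+ j.
  move=> bA; have cb1 : 'chi_i b ^+ #|A| = 1.
    by rewrite -lin_charX // expg_cardG // lin_char1.
  have [j ->] := prim_rootP zP cb1.
  (* Here [j] lies in ['I_#|A|]; [inord] moves it to the successor form ['I_n.+1], which carries
     addition modulo [#|A|]. *)
  by exists (inord j); rewrite inordK // card_predS.
pose k : T := [ffun b =>
  if b \in A then odflt 0 [pick j : 'I_n.+1 | 'chi_i b == z ^+ j] else 0].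
have kE b : b \in A -> 'chi_i b = z ^+ (k b).
  move=> bA; rewrite ffunE bA; case: pickP => [j /eqP //|h].
  by have [j] := logE b bA; rewrite h.
exists k; last by apply: contraNneq ia => ka; rewrite kE // ka.
apply/dualP; split=> [b c bA cA|b bA]; last by rewrite ffunE (negbTE bA).
apply: (prim_expr_ord_inj zP).
by rewrite (prim_expr_ordD _ _ zP) -!kE ?groupM // lin_charM.
Qed.

End Dual.

Section Characters.
Variables (R : realType) (gT : finGroupType) (A : {group gT}) (z : R[i]).
Hypothesis zP : #|A|.-primitive_root z.
Local Notation n := #|A|.-1.
Local Notation T := {ffun gT -> 'I_n.+1}.
Implicit Types k l : T.

Definition chi k a : R[i] := z ^+ (k a).

Lemma norm_z : `|z| = 1.
Proof.
have := congr1 Num.norm (prim_expr_order zP); rewrite normrX normr1 => /eqP.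
by rewrite pexpr_eq1 ?normr_ge0 ?cardG_gt0 // => /eqP.
Qed.

Lemma norm_chi k a : `|chi k a| = 1.
Proof. by rewrite normrX norm_z expr1n. Qed.

Lemma chi_conj k a : (chi k a)^* * chi k a = 1.
Proof. by rewrite mulrC -normCK norm_chi expr1n. Qed.

Lemma chi0 a : chi 0 a = 1. Proof. by rewrite /chi ffunE. Qed.

Lemma chi1 k : k \in dual A -> chi k 1%g = 1.
Proof. by move=> kD; rewrite /chi dual1. Qed.

Lemma chiM k a b : k \in dual A -> a \in A -> b \in A ->
  chi k (a * b)%g = chi k a * chi k b.
Proof. by move=> kD aA bA; rewrite /chi dualM // (prim_expr_ordD _ _ zP). Qed.

Lemma chiD k l a : chi (k + l) a = chi k a * chi l a.
Proof. by rewrite /chi ffunE (prim_expr_ordD _ _ zP). Qed.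

Lemma chi_inj k l : k \in dual A -> l \in dual A ->
  (forall a, a \in A -> chi k a = chi l a) -> k = l.
Proof.
move=> kD lD kl; apply/ffunP => a; have [aA|aA] := boolP (a \in A).
  by apply: (prim_expr_ord_inj zP); exact: kl.
by rewrite !dual_out.
Qed.

(** Translation by some [b] with [chi k b != 1] multiplies the sum by [chi k b] without changing
    it. *)
Lemma chi_sum_group k : k \in dual A -> k != 0 -> \sum_(a in A) chi k a = 0.
Proof.
move=> kD k0.
have [b bA kb] : exists2 b, b \in A & chi k b != 1.
  apply/exists_inP; apply: contraNT k0 => /exists_inPn h; apply/eqP.
  apply: chi_inj => //; first exact: dual0.
  by move=> a aA; rewrite chi0; apply/eqP; have := h a aA; rewrite negbK.
set s := \sum_(a in A) _.
have : s = chi k b * s.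
  rewrite {1}/s (reindex_inj (mulgI b)) /= mulr_sumr.
  by apply: eq_big => [a|a]; rewrite groupMl // => aA; rewrite chiM.
move/eqP; rewrite -subr_eq0 -{1}[s]mul1r -mulrBl mulf_eq0 subr_eq0 eq_sym.
by rewrite (negbTE kb) => /eqP.
Qed.

(** Same argument on the dual side, translating by a character that separates [a] from 1. *)
Lemma chi_sum_dual_eq0 a : abelian A -> a \in A -> a != 1%g ->
  \sum_(k in dual A) chi k a = 0.
Proof.
move=> hA aA a1; have [l lD la] := dual_separates hA aA a1.
set s := \sum_(k in _) _.
have : s = chi l a * s.
  rewrite {1}/s (reindex_inj (addrI l)) /= mulr_sumr.
  apply: eq_big => [k|k _]; last by rewrite chiD.
  apply/idP/idP => [h|kD]; last exact: dualD.
  by rewrite -(addKr l k) dualD // dualN.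
move/eqP; rewrite -subr_eq0 -{1}[s]mul1r -mulrBl mulf_eq0 subr_eq0 eq_sym.
case/orP => /eqP // la1; case/eqP: la; apply: (prim_expr_ord_inj zP).
by rewrite -[LHS]/(chi l a) la1.
Qed.

(** The double sum of [chi k a] is computed in both orders: only [k = 0] contributes in one, only
    [a = 1] in the other. *)
Lemma card_dual : abelian A -> #|dual A| = #|A|.
Proof.
move=> hA; have : \sum_(k in dual A) \sum_(a in A) chi k a = #|A|%:R.
  rewrite (bigD1 (0 : T)) ?dual0 //= [X in _ + X]big1 ?addr0 => [|k /andP[kD k0]].
    by under eq_bigr do rewrite chi0; rewrite sumr_const.
  exact: chi_sum_group.
rewrite exchange_big (bigD1 1%g) ?group1 //= [X in _ + X]big1 ?addr0; last first.
  by move=> a /andP[aA a1]; exact: chi_sum_dual_eq0.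
under eq_bigr => k kD do rewrite chi1 //.
by rewrite sumr_const => /eqP; rewrite eqr_nat => /eqP.
Qed.

Lemma chi_sum_dual1 : abelian A -> \sum_(k in dual A) chi k 1%g = #|A|%:R.
Proof.
move=> hA; under eq_bigr => k kD do rewrite chi1 //.
by rewrite sumr_const card_dual.
Qed.

End Characters.

(** * Isotypic components of a representation *)

Section Isotypic.
Variables (R : realType) (gT : finGroupType) (Gam A : {group gT}) (z : R[i]).
Hypothesis zP : #|A|.-primitive_root z.
Hypothesis hA : abelian A.
Hypothesis nA : normal A Gam.
Variable rho : unitary_rep R Gam.
Local Notation V := (urep_space rho).
Local Notation act := (urep_act rho).
Local Notation dual := (dual A).
Local Notation T := {ffun gT -> 'I_(#|A|.-1.+1)}.
Local Notation chi := (chi z).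
Implicit Types (u v w : V) (k l : T).

Let AGam a : a \in A -> a \in Gam.
Proof. by move: a; apply/fintype.subsetP; exact: normal_sub. Qed.

Definition isotypic k w := forall b, b \in A -> act b w = chi k b *: w.

Lemma isotypicZ k c w : isotypic k w -> isotypic k (c *: w).
Proof. by move=> kw b bA; rewrite linearZ /= kw // !scalerA mulrC. Qed.

(** By unitarity each [b] in [A] multiplies the inner product by [chi k b * (chi l b)^*]; were it
    non-zero, the two characters would agree on [A]. *)
Lemma isotypic_orth k l u w : k \in dual -> l \in dual -> k != l ->
  isotypic k u -> isotypic l w -> rdot u w = 0.
Proof.
move=> kD lD kl ku lw; suff -> : rdot u w = complex.Re (0 : R[i]) by [].
congr complex.Re; apply/eqP; apply: contraNT kl => uw0; apply/eqP.
apply: (chi_inj zP) => // b bA.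
have := @urep_unitary _ _ _ rho b u w (AGam bA); rewrite ku // lw //.
rewrite linearZl_LR linearZr_LR /= mulrA -[X in _ = X]mul1r.
move/(mulIf uw0) => /(congr1 (fun c => c * chi l b)).
by rewrite mul1r -mulrA (chi_conj zP) mulr1.
Qed.

Lemma usq_isotypic_sum (w : T -> V) : (forall k, k \in dual -> isotypic k (w k)) ->
  usq (rho := rho) (\sum_(k in dual) w k) = \sum_(k in dual) usq (w k).
Proof.
move=> iw; rewrite usq_rdot /rdot linear_sumlz raddf_sum; apply: eq_bigr => k kD.
rewrite linear_sumr raddf_sum (bigD1 k) //= [X in _ + X]big1 ?addr0 ?usq_rdot //.
move=> l /andP[lD lk].
by apply: (isotypic_orth kD lD _ (iw k kD) (iw l lD)); rewrite eq_sym.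
Qed.

(** The usual averaging formula for the orthogonal projection onto the [k]-isotypic component. *)
Definition isoproj k v : V :=
  (#|A|%:R)^-1 *: \sum_(a in A) (chi k a)^* *: act a v.

Lemma isoprojB k u v : isoproj k (u - v) = isoproj k u - isoproj k v.
Proof.
rewrite /isoproj -scalerBr -sumrB; congr (_ *: _); apply: eq_bigr => a _.
by rewrite linearB scalerBr.
Qed.

(** After exchanging the sums, orthogonality on the dual side leaves only the term [a = 1]. *)
Lemma isoproj_sum v : \sum_(k in dual) isoproj k v = v.
Proof.
rewrite -scaler_sumr exchange_big /=.
under eq_bigr do rewrite -scaler_suml -rmorph_sum.
rewrite (bigD1 1%g) ?group1 //= [X in _ + X]big1 ?addr0; last first.
  move=> a /andP[aA a1].
  by rewrite (chi_sum_dual_eq0 zP) // rmorph0 scale0r.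
rewrite (chi_sum_dual1 zP) // rmorph_nat urep_act1 scalerA.
by rewrite mulVf ?scale1r // pnatr_eq0 -lt0n cardG_gt0.
Qed.

Lemma isoproj_isotypic k v : k \in dual -> isotypic k (isoproj k v).
Proof.
move=> kD b bA; rewrite linearZ /= scalerA mulrC -scalerA; congr (_ *: _).
rewrite linear_sum scaler_sumr [RHS](reindex_inj (mulgI b)) /=.
apply: eq_big => [a|a aA]; first by rewrite groupMl.
rewrite linearZ /= -urep_actM ?AGam // scalerA (chiM zP) // rmorphM.
by rewrite mulrA [chi k b * _]mulrC (chi_conj zP) mul1r.
Qed.

Lemma usq_isoproj v : usq v = \sum_(k in dual) usq (isoproj k v).
Proof.
by rewrite -usq_isotypic_sum ?isoproj_sum // => k kD; exact: isoproj_isotypic.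
Qed.

Lemma usq_displacement b v : b \in A ->
  usq (act b v - v) = \sum_(k in dual) nsq (chi k b - 1) * usq (isoproj k v).
Proof.
move=> bA; under eq_bigr do rewrite -usqZ.
rewrite -usq_isotypic_sum => [|k kD]; last exact/isotypicZ/isoproj_isotypic.
congr usq; rewrite -{1 2}(isoproj_sum v) linear_sum -sumrB; apply: eq_bigr => k kD.
by rewrite (isoproj_isotypic v kD bA) scalerBl scale1r.
Qed.

(** Reindexing the average by conjugation and using [g * a ^ g = a * g] moves [g] through the
    projection. *)
Lemma act_isoproj g k l v : g \in Gam ->
  (forall a, a \in A -> chi l a = chi k (a ^ g)%g) ->
  act g (isoproj k v) = isoproj l (act g v).
Proof.
move=> gG lk; rewrite linearZ /=; congr (_ *: _).
rewrite linear_sum [LHS](reindex_inj (conjg_inj g)) /=.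
have gN : g \in 'N(A)%g by apply: fintype.subsetP gG; exact: normal_norm.
apply: eq_big => [a|a]; rewrite memJ_norm // => aA.
have aG := AGam aA; have agG : (a ^ g)%g \in Gam by rewrite groupJ.
by rewrite linearZ /= lk // -!urep_actM // -conjgC.
Qed.

Lemma isoproj0_fixed a v : a \in A -> act a (isoproj 0 v) = isoproj 0 v.
Proof. by move=> aA; rewrite (isoproj_isotypic v (dual0 A)) // chi0 scale1r. Qed.

(** The reverse triangle inequality, squared. It is what allows components to be replaced by their
    norms. *)
Lemma usq_sqrt_dist u w : (Num.sqrt (usq u) - Num.sqrt (usq w)) ^+ 2 <= usq (u - w).
Proof.
have nE t : `|t| = (Num.sqrt (usq (rho := rho) t))%:C%C.
  apply/eqP; rewrite -(@eqrXn2 _ 2) ?normr_ge0 // ?lecR ?sqrtr_ge0 //.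
  by rewrite usqE -rmorphXn /= sqr_sqrtr // usq_ge0.
have := ler_dist_dist u w; rewrite !nE -rmorphB normc_def /= expr0n addr0 lecR.
rewrite sqrtr_sqr => h; rewrite -[X in _ <= X]sqr_sqrtr ?usq_ge0 //.
by rewrite -real_normK ?num_real // lerXn2r ?nnegrE ?sqrtr_ge0.
Qed.

End Isotypic.

(** * The action of [H] on the characters of [A] *)

Section DualAction.
Variables (gT hT : finGroupType) (A : {group gT}) (H : {group hT}).
Variable to : groupAction H A.
Local Notation T := {ffun gT -> 'I_(#|A|.-1.+1)}.
Local Notation dual := (dual A).
Implicit Types k : T.

(** Precomposition turns the right action [to] into a left action on characters. The value 0 outside
    [A] is the normalisation demanded by [dual]. *)
Definition hdual x k : T := [ffun a => if a \in A then k (to a x) else 0].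

Lemma act_in a x : x \in H -> a \in A -> to a x \in A.
Proof. by move=> xH aA; rewrite gact_stable. Qed.

Lemma hdual_dual x k : x \in H -> k \in dual -> hdual x k \in dual.
Proof.
move=> xH kD; apply/dualP; split=> [a b aA bA|a aA]; last by rewrite ffunE (negbTE aA).
by rewrite !ffunE groupM // aA bA gactM // dualM // act_in.
Qed.

Lemma hdualM x y k : x \in H -> y \in H -> hdual (x * y)%g k = hdual x (hdual y k).
Proof.
move=> xH yH; apply/ffunP => a; rewrite !ffunE; case: ifP => // aA.
by rewrite act_in // actMin.
Qed.

Lemma hdual1 k : k \in dual -> hdual 1%g k = k.
Proof.
move=> kD; apply/ffunP => a; rewrite ffunE act1; case: ifPn => // aA.
by rewrite dual_out.
Qed.

Lemma hdual0 x : hdual x 0 = 0.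
Proof. by apply/ffunP => a; rewrite !ffunE; case: ifP. Qed.

Lemma hdualK x k : x \in H -> k \in dual -> hdual x^-1 (hdual x k) = k.
Proof. by move=> xH kD; rewrite -hdualM ?groupV // mulVg hdual1. Qed.

Lemma hdualVK x k : x \in H -> k \in dual -> hdual x (hdual x^-1 k) = k.
Proof. by move=> xH kD; rewrite -hdualM ?groupV // mulgV hdual1. Qed.

Lemma reindex_hdual (R : nmodType) (F : T -> R) x : x \in H ->
  \sum_(k in dual | k != 0) F k = \sum_(k in dual | k != 0) F (hdual x k).
Proof.
move=> xH; rewrite (reindex_onto (hdual x) (hdual x^-1)) /=; last first.
  by move=> k /andP[kD _]; rewrite hdualVK.
apply: eq_bigl => k; apply/andP/andP => [[/andP[xkD xk0] /eqP xkK]|[kD k0]].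
  split; first by rewrite -xkK hdual_dual ?groupV.
  by apply: contraNneq xk0 => ->; rewrite hdual0.
rewrite hdual_dual // hdualK // eqxx /=; split=> //.
by apply: contraNneq k0 => xk0; rewrite -(hdualK xH kD) xk0 hdual0.
Qed.

End DualAction.

Lemma nsqM (R : realType) (u v : R[i]) : nsq (u * v) = nsq u * nsq v.
Proof. by case: u v => a b [c d]; rewrite /nsq /=; ring. Qed.

(** The unit circle has diameter 2. *)
Lemma nsq_chi_sub1 (R : realType) (u : R[i]) : `|u| = 1 -> nsq (u - 1) <= 4.
Proof.
move=> u1; have := congr1 (fun r => r ^+ 2) u1; rewrite -nsqE expr1n => /complexI.
case: u {u1} => a b; rewrite /nsq /= oppr0 addr0 => h.
have := sqr_ge0 b; nra.
Qed.

(** * The spectral gap of the extension *)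

Section Extension.
Variables (R : realType) (gT hT : finGroupType).
Variables (Gam A : {group gT}) (H : {group hT}) (to : groupAction H A).
Variable phi : {morphism (Gam / A)%g >-> hT}.
Variables (S : {set hT}) (B : {set gT}) (lift : hT -> gT) (epsH epsA : R).
Hypothesis hA : abelian A.
Hypothesis hext : group_extension phi to.
Hypothesis hSH : S \subset H.
Hypothesis hBA : B \subset A.
Hypothesis hlift : is_lifting phi S lift.
Hypothesis hH : avg_kazhdan_constant H (enum S) epsH.
Hypothesis hAB : avg_kazhdan_constant A (orbit_multiset to B) epsA.
Variable z : R[i].
Hypothesis zP : #|A|.-primitive_root z.
Variable rho : unitary_rep R Gam.
Hypothesis rho0 : no_invariants rho.
Local Notation act := (urep_act rho).
Local Notation dual := (dual A).
Local Notation chi := (chi z).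
Local Notation hdual := (hdual to).
Local Notation T := {ffun gT -> 'I_(#|A|.-1.+1)}.
Variable v : urep_space rho.
Local Notation P := (@isoproj R gT Gam A z rho).

Let nA : normal A Gam. Proof. by case: hext. Qed.

Let SH s : s \in S -> s \in H. Proof. exact: (fintype.subsetP hSH). Qed.

Let phi_inj : ('injm phi)%g.
Proof. by case: hext => _ /isomP[]. Qed.

Let phiH : (phi @* (Gam / A))%g = H :> {set hT}.
Proof. by case: hext => _ /isomP[]. Qed.

Lemma to_conj a g : a \in A -> g \in Gam -> to a (phi (coset A g)) = (a ^ g)%g.
Proof. by case: hext => _ _; apply. Qed.

Lemma phi_im g : g \in Gam -> phi (coset A g) \in H.
Proof.
move=> gG; rewrite -phiH; apply: mem_morphim; exact: mem_quotient.
Qed.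

Lemma phi_lift x : x \in H -> exists2 g, g \in Gam & phi (coset A g) = x.
Proof.
rewrite -phiH => /morphimP[c _ /morphimP[g _ gG ->] ->].
by exists g.
Qed.

Lemma phi_eq g h : g \in Gam -> h \in Gam ->
  phi (coset A g) = phi (coset A h) -> (g^-1 * h)%g \in A.
Proof.
move=> gG hG; move/(injmP phi_inj _ _ (mem_quotient A gG) (mem_quotient A hG)) => e.
have N x : x \in Gam -> x \in 'N(A)%g by apply: fintype.subsetP; exact: normal_norm.
apply: coset_idr; first by rewrite groupM ?groupV // N.
by rewrite morphM ?groupV ?N // morphV ?N //= e mulVg.
Qed.

Lemma phiM g h : g \in Gam -> h \in Gam ->
  phi (coset A (g * h)%g) = (phi (coset A g) * phi (coset A h))%g.
Proof.
move=> gG hG.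
have N x : x \in Gam -> x \in 'N(A)%g by apply: fintype.subsetP; exact: normal_norm.
by rewrite morphM ?N // morphM ?mem_quotient.
Qed.

(** A set-theoretic section, not multiplicative in general. By [act_v0] its choices do not affect
    the action on the [A]-fixed vector [v0]. *)
Definition sec (x : hT) : gT := odflt 1%g [pick g in Gam | phi (coset A g) == x].

Lemma secP x : x \in H -> sec x \in Gam /\ phi (coset A (sec x)) = x.
Proof.
move=> xH; rewrite /sec; case: pickP => [g /andP[gG /eqP //]|h].
by have [g gG gx] := phi_lift xH; have := h g; rewrite gG gx eqxx.
Qed.

Let v0 := P 0 v.

Lemma act_v0 g h : g \in Gam -> h \in Gam ->
  phi (coset A g) = phi (coset A h) -> act g v0 = act h v0.
Proof.
move=> gG hG e; have aA := phi_eq gG hG e.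
have aG : (g^-1 * h)%g \in Gam by rewrite groupM ?groupV.
have fx : act (g^-1 * h)%g v0 = v0 by exact: isoproj0_fixed.
by rewrite -[h in RHS](mulKVg g) [in RHS]urep_actM // fx.
Qed.

(** The vector-valued Poincare inequality of [H] is applied to the orbit map [F] of [v0]. *)
Lemma fixed_part_gap : epsH * #|S|%:R * usq v0 <=
  \sum_(s in S) usq (act (lift s) v0 - v0).
Proof.
pose F y := act (sec y) v0.
(* The sum over the orbit is fixed by [Gam], hence zero by [rho0]. *)
have F0 : \sum_(y in H) F y = 0.
  apply: rho0 => g gG; rewrite linear_sum.
  rewrite [RHS](reindex_inj (mulgI (phi (coset A g)))) /=.
  apply: eq_big => [y|y yH]; first by rewrite groupMl // phi_im.
  have [sG sy] := secP yH.
  have [tG ty] := secP (groupM (phi_im gG) yH).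
  rewrite -urep_actM //; apply: act_v0; rewrite ?groupM //.
  by rewrite phiM // sy ty.
have := kazhdan_poincare_vect hH F0.
rewrite -cardE big_enum /= (eq_bigr (fun=> usq v0)) => [|y yH]; last first.
  by rewrite usq_act //; have [] := secP yH.
(* By unitarity every [x] in [H] contributes the same displacement of [v0]. *)
have -> : \sum_(t in S) \sum_(x in H) usq (F (x * t)%g - F x) =
    #|H|%:R * \sum_(s in S) usq (act (lift s) v0 - v0).
  rewrite mulr_sumr; apply: eq_bigr => s sS.
  have [lG ls] := hlift sS.
  rewrite mulr_natl -sumr_const; apply: eq_bigr => y yH.
  have [yG yy] := secP yH; have [tG ty] := secP (groupM yH (SH sS)).
  rewrite -[RHS](usq_act _ yG) linearB /= -urep_actM //; congr (usq (_ - _)).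
  by apply: act_v0; rewrite ?groupM // phiM // ty yy ls.
rewrite sumr_const -[usq v0 *+ _]mulr_natl mulrCA. 
by rewrite ler_pM2l ?ltr0n ?cardG_gt0.
Qed.

Let f k : R := Num.sqrt (usq (P k v)).
Let m k : R := #|H|%:R^-1 * \sum_(y in H) f (hdual y k).

Lemma chi_hdual g k a : g \in Gam -> a \in A ->
  chi (hdual (phi (coset A g)) k) a = chi k (a ^ g)%g.
Proof. by move=> gG aA; rewrite /chi ffunE aA to_conj. Qed.


Lemma avg_weight_hdual x k : x \in H -> k \in dual -> m (hdual x k) = m k.
Proof.
move=> xH kD; rewrite /m; congr (_ * _).
rewrite [RHS](reindex_inj (mulIg x)) /=.
apply: eq_big => [y|y yH]; first by rewrite groupMr.
by rewrite hdualM.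
Qed.

(** The Poincare inequality of [H] along the orbit of each [k], summed over [k]. Each [y] in [H]
    permutes the non-trivial characters, so all [y] contribute equally and the factor [#|H|]
    cancels. *)
Lemma weight_variance_le :
  epsH * #|S|%:R * (\sum_(k in dual | k != 0) (f k - m k) ^+ 2) <=
  \sum_(s in S) \sum_(k in dual | k != 0) (f k - f (hdual s k)) ^+ 2.
Proof.
(* The inverse [y^-1] makes right multiplication of [y] by [s] act, through [s^-1], on the character
   already moved by [y^-1], so that reindexing can remove [y]. *)
have poinc k : k \in dual ->
    epsH * #|S|%:R * \sum_(y in H) (f (hdual y^-1 k) - m k) ^+ 2 <=
    \sum_(s in S) \sum_(y in H)
      (f (hdual s^-1 (hdual y^-1 k)) - f (hdual y^-1 k)) ^+ 2.
  move=> kD.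
  have sum0 : \sum_(y in H) (f (hdual y^-1 k) - m k) = 0.
    rewrite sumrB sumr_const -[m k *+ _]mulr_natl /m.
    rewrite mulVKf ?pnatr_eq0 -?lt0n ?cardG_gt0 //.
    apply/eqP; rewrite subr_eq0; apply/eqP.
    rewrite [RHS](reindex_inj invg_inj) /=; apply: eq_bigl => y.
    by rewrite groupV.
  have := kazhdan_poincare hH sum0; rewrite -cardE big_enum => /le_trans; apply.
  apply: ler_sum => s sS; apply: ler_sum => y yH.
  have sH := SH sS.
  by rewrite /= opprB addrA subrK invMg hdualM ?groupV.
have hH0 : 0 < #|H|%:R :> R by rewrite ltr0n cardG_gt0.
rewrite -(ler_pM2l hH0) mulrCA.
have -> : #|H|%:R * (\sum_(k in dual | k != 0) (f k - m k) ^+ 2) =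
    \sum_(k in dual | k != 0) \sum_(y in H) (f (hdual y^-1 k) - m k) ^+ 2.
  rewrite [RHS]exchange_big /= mulr_natl -sumr_const; apply: eq_bigr => y yH.
  rewrite (@reindex_hdual _ _ _ _ to _ _ (y^-1)%g) ?groupV //.
  by apply: eq_bigr => k /andP[kD _]; rewrite avg_weight_hdual ?groupV.
have -> : #|H|%:R * (\sum_(s in S) \sum_(k in dual | k != 0) (f k - f (hdual s k)) ^+ 2) =
    \sum_(k in dual | k != 0) \sum_(s in S) \sum_(y in H)
      (f (hdual s^-1 (hdual y^-1 k)) - f (hdual y^-1 k)) ^+ 2.
  rewrite [RHS]exchange_big /= mulr_sumr; apply: eq_bigr => s sS.
  rewrite [RHS]exchange_big /= mulr_natl -sumr_const; apply: eq_bigr => y yH.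
  rewrite -(@reindex_hdual _ _ _ _ to _
    (fun k => (f (hdual s^-1 k) - f k) ^+ 2) (y^-1)%g) ?groupV //.
  rewrite [RHS](@reindex_hdual _ _ _ _ to _ _ s) ?SH //.
  by apply: eq_bigr => k /andP[kD _]; rewrite hdualK ?SH.
rewrite mulr_sumr; apply: ler_sum => k /andP[kD _]; exact: poinc.
Qed.

(** The lift carries component [k] to component [hdual s k]. The trivial component is kept exactly;
    on the others only the change of norm is retained. *)
Lemma lift_displacement s : s \in S ->
  usq (act (lift s) v0 - v0) +
    \sum_(k in dual | k != 0) (f k - f (hdual s k)) ^+ 2 <=
  usq (act (lift s) v - v).
Proof.
move=> sS; have [gG gs] := hlift sS.
have eqv k : k \in dual -> act (lift s) (P k v) = P (hdual s k) (act (lift s) v).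
  move=> kD; apply: act_isoproj => // a aA.
  by rewrite -[in LHS]gs chi_hdual.
rewrite [leRHS](usq_isoproj zP hA nA) [leRHS](bigD1 (0 : T)) ?dual0 //=.
rewrite isoprojB lerD //.
  by rewrite /v0 eqv ?dual0 // hdual0.
rewrite [leRHS](@reindex_hdual _ _ _ _ to _ _ s) ?SH //.
apply: ler_sum => k /andP[kD _].
rewrite isoprojB -eqv // /f -(usq_act (P k v) gG).
exact: usq_sqrt_dist.
Qed.

(** The real and imaginary parts of [chi k] have mean zero on [A], so the Poincare inequality of [A]
    applies to both. As [chi k] is multiplicative of modulus 1, each [a] in [A] contributes the same
    amount and [#|A|] cancels. *)
Lemma nontrivial_character_gap k : k \in dual -> k != 0 ->
  epsA * #|B|%:R * #|H|%:R <=
  \sum_(b in B) \sum_(x in H) nsq (chi (hdual x k) b - 1).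
Proof.
move=> kD k0.
have s0 := chi_sum_group zP kD k0.
have sR : \sum_(a in A) complex.Re (chi k a) = 0 by rewrite -raddf_sum s0.
have sI : \sum_(a in A) complex.Im (chi k a) = 0 by rewrite -raddf_sum s0.
have := lerD (kazhdan_poincare hAB sR) (kazhdan_poincare hAB sI).
rewrite -mulrDr -!big_split /=.
have -> : \sum_(a in A) (complex.Re (chi k a) ^+ 2 + complex.Im (chi k a) ^+ 2) = #|A|%:R.
  rewrite -sumr_const; apply: eq_bigr => a aA; apply: complexI.
  by rewrite -[LHS]/((nsq (chi k a))%:C%C) nsqE (norm_chi zP) expr1n.
rewrite /orbit_multiset size_allpairs -!cardE natrM big_allpairs_dep /= big_enum /=.
have -> : \sum_(b in B) \sum_(x <- enum H)
    ((\sum_(a in A) (complex.Re (chi k (a * to b x)%g) - complex.Re (chi k a)) ^+ 2) +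
    \sum_(a in A) (complex.Im (chi k (a * to b x)%g) - complex.Im (chi k a)) ^+ 2) =
    (\sum_(b in B) \sum_(x in H) nsq (chi (hdual x k) b - 1)) * #|A|%:R.
  rewrite mulr_suml; apply: eq_bigr => b bB; have bA := fintype.subsetP hBA b bB.
  rewrite mulr_suml big_enum; apply: eq_bigr => x xH /=.
  rewrite mulr_natr -sumr_const -big_split; apply: eq_bigr => a aA /=.
  have -> : chi (hdual x k) b = chi k (to b x) by rewrite /chi ffunE bA.
  rewrite -[RHS]mul1r -[X in _ = X * _](_ : nsq (chi k a) = 1); last first.
    by apply: complexI; rewrite nsqE (norm_chi zP) expr1n.
  rewrite -nsqM mulrBr mulr1 -(chiM zP) ?act_in //.
  by case: (chi k (a * _)%g) => ? ?; case: (chi k a).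
by rewrite mulrA ler_pM2r // ltr0n cardG_gt0.
Qed.

(** Since [m] is constant on [H]-orbits, the sum over [B] may be averaged over [H], which produces
    the sum over the orbits of [B] bounded in [nontrivial_character_gap]. *)
Lemma averaged_weight_gap :
  epsA * #|B|%:R * \sum_(k in dual | k != 0) m k ^+ 2 <=
  \sum_(b in B) \sum_(k in dual | k != 0) nsq (chi k b - 1) * m k ^+ 2.
Proof.
have hH0 : 0 < #|H|%:R :> R by rewrite ltr0n cardG_gt0.
rewrite -(ler_pM2l hH0).
have -> : #|H|%:R *
    (\sum_(b in B) \sum_(k in dual | k != 0) nsq (chi k b - 1) * m k ^+ 2) =
    \sum_(k in dual | k != 0)
      (\sum_(b in B) \sum_(x in H) nsq (chi (hdual x k) b - 1)) * m k ^+ 2.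
  under [RHS]eq_bigr do rewrite mulr_suml.
  rewrite [RHS]exchange_big /= mulr_sumr; apply: eq_bigr => b bB.
  under [RHS]eq_bigr do rewrite mulr_suml.
  rewrite [RHS]exchange_big /= mulr_natl -sumr_const; apply: eq_bigr => x xH.
  rewrite [LHS](@reindex_hdual _ _ _ _ to _ _ x) //.
  by apply: eq_bigr => k /andP[kD _]; rewrite avg_weight_hdual.
rewrite mulrA mulr_sumr; apply: ler_sum => k /andP[kD k0].
by rewrite ler_wpM2r ?sqr_ge0 // mulrC; exact: nontrivial_character_gap.
Qed.

Lemma usq_le_displacements :
  epsH * epsA * #|S|%:R * #|B|%:R * usq v <=
  24 * (#|B|%:R * \sum_(s in S) usq (act (lift s) v - v) +
        #|S|%:R * \sum_(b in B) usq (act b v - v)).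
Proof.
pose E1 := \sum_(k in dual | k != 0) (f k - m k) ^+ 2.
pose M := \sum_(k in dual | k != 0) m k ^+ 2.
pose X := \sum_(s in S) usq (act (lift s) v - v).
pose Y := \sum_(b in B) usq (act b v - v).
pose X0 := \sum_(s in S) usq (act (lift s) v0 - v0).
pose X1 := \sum_(s in S) \sum_(k in dual | k != 0) (f k - f (hdual s k)) ^+ 2.
have h1 : epsH * #|S|%:R * usq v0 <= X0 by exact: fixed_part_gap.
have h2 : epsH * #|S|%:R * E1 <= X1 by exact: weight_variance_le.
have h3 : X0 + X1 <= X.
  by rewrite /X0 /X1 -big_split; apply: ler_sum => s; exact: lift_displacement.
have f2 k : f k ^+ 2 = usq (P k v) by rewrite sqr_sqrtr ?usq_ge0.
(* With [c = nsq (chi k b - 1) <= 4], one has [c m^2 <= 2 c f^2 + 2 c (f - m)^2]; the last term is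
   at most [8 (f - m)^2]. *)
have h4 : epsA * #|B|%:R * M <= 2 * Y + 8 * #|B|%:R * E1.
  apply: le_trans averaged_weight_gap _.
  have -> : 2 * Y + 8 * #|B|%:R * E1 = \sum_(b in B) (2 * usq (act b v - v) + 8 * E1).
    by rewrite big_split /= -mulr_sumr sumr_const -mulr_natl; congr (_ + _); ring.
  apply: ler_sum => b bB; have bA := fintype.subsetP hBA b bB.
  rewrite (usq_displacement zP hA nA v bA) [in leRHS](bigD1 (0 : T)) ?dual0 //=.
  rewrite chi0 subrr.
  have -> : nsq (0 : R[i]) = 0 by rewrite /nsq /= expr0n addr0.
  rewrite mul0r add0r /E1 !mulr_sumr -big_split /=; apply: ler_sum => k _.
  rewrite -f2; have := nsq_chi_sub1 (norm_chi zP k b); have := nsq_ge0 (chi k b - 1).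
  move: (nsq _) (f k) (m k) => c x y c0 c4.
  have : 0 <= c * (2 * x - y) ^+ 2 by rewrite mulr_ge0 ?sqr_ge0.
  have : 0 <= (4 - c) * (x - y) ^+ 2 by rewrite mulr_ge0 ?sqr_ge0 ?subr_ge0.
  nra.
have h5 : usq v <= usq v0 + 2 * M + 2 * E1.
  rewrite (usq_isoproj zP hA nA) [leLHS](bigD1 (0 : T)) ?dual0 //= -addrA lerD2l.
  rewrite /M /E1 !mulr_sumr -big_split /=; apply: ler_sum => k _.
  by rewrite -f2; have := sqr_ge0 (f k - 2 * m k); nra.
rewrite -/X -/Y.
have v00 := usq_ge0 v0.
have E10 : 0 <= E1 by apply: sumr_ge0 => k _; exact: sqr_ge0.
have M0 : 0 <= M by apply: sumr_ge0 => k _; exact: sqr_ge0.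
have Y0 : 0 <= Y by apply: sumr_ge0 => k _; exact: usq_ge0.
have := kazhdan_le4 hH; have := kazhdan_gt0 hH.
have := kazhdan_le4 hAB; have := kazhdan_gt0 hAB.
have nS0 : 0 <= #|S|%:R :> R by [].
have nB0 : 0 <= #|B|%:R :> R by [].
move: h1 h2 h3 h4 h5 v00 E10 M0 Y0 nS0 nB0.
move: (usq v) (usq v0) E1 M X Y X0 X1 (#|S|%:R : R) (#|B|%:R : R).
move=> q q0 E1' M' X' Y' X0' X1' s b h1 h2 h3 h4 h5 v00 E10 M0 Y0 nS0 nB0 a0 a4 e0 e4.
have X00 : 0 <= X0' by apply: le_trans h1; rewrite !mulr_ge0 // ltW.
have X10 : 0 <= X1' by apply: le_trans h2; rewrite !mulr_ge0 // ltW.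
have esb0 : 0 <= epsH * epsA * s * b by rewrite !mulr_ge0 // ltW.
apply: le_trans (ler_wpM2l esb0 h5) _.
(* By [h5] the quantity to bound is [t1] plus twice [t2] and [t3]. The coefficient of [b * X1'] is
   then 2 * 8 + 2 * 4 = 24, the largest of the three. *)
have t1 : epsH * epsA * s * b * q0 <= 4 * b * X0'.
  apply: (@le_trans _ _ (epsA * b * X0')).
    rewrite (_ : _ * q0 = epsA * b * (epsH * s * q0)); last by ring.
    by rewrite ler_wpM2l // mulr_ge0 // ltW.
  by rewrite !ler_wpM2r.
have t2 : epsH * epsA * s * b * M' <= 8 * s * Y' + 8 * b * X1'.
  rewrite (_ : _ * M' = epsH * s * (epsA * b * M')); last by ring.
  apply: le_trans (ler_wpM2l (_ : 0 <= epsH * s) h4) _.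
    by rewrite mulr_ge0 // ltW.
  rewrite (_ : _ * (_ + _) = epsH * (2 * s * Y') + 8 * b * (epsH * s * E1')); last by ring.
  apply: lerD; last by rewrite ler_wpM2l // mulr_ge0.
  rewrite (_ : 8 * s * Y' = 4 * (2 * s * Y')); last by ring.
  by rewrite ler_wpM2r // !mulr_ge0.
have t3 : epsH * epsA * s * b * E1' <= 4 * b * X1'.
  apply: (@le_trans _ _ (epsA * b * X1')).
    rewrite (_ : _ * E1' = epsA * b * (epsH * s * E1')); last by ring.
    by rewrite ler_wpM2l // mulr_ge0 // ltW.
  by rewrite !ler_wpM2r.
have bX : 0 <= b * (X' - X0' - X1') by rewrite mulr_ge0 // -addrA -opprD subr_ge0.
have bX0 : 0 <= b * X0' by rewrite mulr_ge0.
have bX1 : 0 <= b * X1' by rewrite mulr_ge0.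
have sY0 : 0 <= s * Y' by rewrite mulr_ge0.
lra.
Qed.

End Extension.

(** * Generation of the extension and the final constant *)

Lemma extension_generated (gT hT : finGroupType)
    (Gam A : {group gT}) (H : {group hT}) (to : groupAction H A)
    (phi : {morphism (Gam / A)%g >-> hT})
    (S : {set hT}) (B : {set gT}) (lift : hT -> gT)
    (hext : group_extension phi to) (hBA : B \subset A)
    (hlift : is_lifting phi S lift)
    (genH : <<[set t in enum S]>>%g = H :> {set hT})
    (genA : <<[set t in orbit_multiset to B]>>%g = A :> {set gT}) :
  <<[set t in lifting_multiset S lift ++ enum B]>>%g = Gam :> {set gT}.
Proof.
pose K := <<[set t in lifting_multiset S lift ++ enum B]>>%G.
rewrite -[LHS]/(K : {set gT}).
have [nA _ _] := hext.
have AG : A \subset Gam by exact: normal_sub.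
have KG : K \subset Gam.
  rewrite gen_subG; apply/fintype.subsetP => t; rewrite inE mem_cat mem_enum.
  case/orP => [/mapP[s]|tB]; last exact/(fintype.subsetP AG)/(fintype.subsetP hBA).
  by rewrite mem_enum => sS ->; case: (hlift _ sS).
(* The lifts make [K] map onto [H], so the [H]-orbits of [B] are obtained by conjugating within [K];
   hence [K] contains [A], and then all of [Gam]. *)
have KH x : x \in H -> exists2 k, k \in K & phi (coset A k) = x.
  have : H \subset (phi @* (K / A))%g.
    rewrite -genH gen_subG; apply/fintype.subsetP => s; rewrite inE mem_enum => sS.
    have [lG <-] := hlift s sS; have lK : lift s \in K.
      by rewrite mem_gen // inE mem_cat map_f // mem_enum.
    by apply: mem_morphim; exact: mem_quotient.
  move=> /fintype.subsetP sH /sH /morphimP[c _ /morphimP[k _ kK ->] ->].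
  by exists k.
have AK : A \subset K.
  rewrite -genA gen_subG; apply/fintype.subsetP => t; rewrite inE.
  case/allpairsP => -[b x] /= []; rewrite !mem_enum => bB xH ->.
  have [k kK <-] := KH x xH.
  have bA := fintype.subsetP hBA b bB; have kG := fintype.subsetP KG k kK.
  rewrite (to_conj hext) // groupJ // mem_gen // inE mem_cat.
  by rewrite [X in _ || X]mem_enum bB orbT.
apply/eqP; rewrite finset.eqEsubset KG; apply/fintype.subsetP => g gG.
have [k kK e] := KH _ (phi_im hext gG).
have := phi_eq hext (fintype.subsetP KG k kK) gG e.
by move/(fintype.subsetP AK) => kgK; rewrite -(mulKVg k g) groupM.
Qed.

(** The constant 48 is 24 times the 2 in [(s + b)^2 <= 2 (s b + s^2 + b^2)]; the other loss is
    [b X + s Y <= (X + Y) (s + b)]. *)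
Lemma avg_displacement_lower_bound (R : realFieldType) (eps q X Y s b : R) :
  0 < s -> 0 < b -> 0 < q -> 0 <= X -> 0 <= Y ->
  eps * s * b * q <= 24 * (b * X + s * Y) ->
  eps / (48 * (1 + s / b + b / s)) <= (s + b)^-1 * ((X + Y) / q).
Proof.
move=> s0 b0 q0 X0 Y0 h.
have sb0 : 0 < s + b by rewrite addr_gt0.
have D0 : 0 < s * b + s ^+ 2 + b ^+ 2 by rewrite !addr_gt0 ?mulr_gt0 ?exprn_gt0.
have -> : eps / (48 * (1 + s / b + b / s)) =
    eps * s * b / (48 * (s * b + s ^+ 2 + b ^+ 2)).
  by field; rewrite !gt_eqF // (_ : s * b + _ = s * b + s ^+ 2 + b ^+ 2) ?gt_eqF //; ring.
have -> : (s + b)^-1 * ((X + Y) / q) = (X + Y) / ((s + b) * q).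
  by field; rewrite !gt_eqF.
rewrite ler_pdivrMr ?mulr_gt0 // [leRHS]mulrAC ler_pdivlMr ?mulr_gt0 //.
have h1 : b * X + s * Y <= (X + Y) * (s + b).
  by have := mulr_ge0 X0 (ltW s0); have := mulr_ge0 Y0 (ltW b0); lra.
have h2 : (s + b) ^+ 2 <= 2 * (s * b + s ^+ 2 + b ^+ 2).
  by have := sqr_ge0 (s - b); nra.
rewrite (_ : _ * ((s + b) * q) = eps * s * b * q * (s + b)); last by ring.
apply: le_trans (ler_wpM2r (ltW sb0) h) _.
apply: (@le_trans _ _ (24 * ((X + Y) * (s + b)) * (s + b))).
  by rewrite ler_wpM2r ?(ltW sb0) // ler_wpM2l.
rewrite (_ : _ * (s + b) = (X + Y) * (24 * (s + b) ^+ 2)); last by ring.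
rewrite ler_wpM2l ?addr_ge0 //; lra.
Qed.

Theorem theorem1p6 (R : realType) (gT hT : finGroupType)
    (Gam A : {group gT}) (H : {group hT}) (to : groupAction H A)
    (phi : {morphism (Gam / A)%g >-> hT})
    (S : {set hT}) (B : {set gT}) (lift : hT -> gT) (epsH epsA : R)
    (hA : abelian A)
    (hext : group_extension phi to)
    (hSH : S \subset H) (hS0 : S != finset.set0)
    (hBA : B \subset A) (hB0 : B != finset.set0)
    (hlift : is_lifting phi S lift)
    (hH : avg_kazhdan_constant H (enum S) epsH)
    (hAB : avg_kazhdan_constant A (orbit_multiset to B) epsA) :
  exists eps : R,
    avg_kazhdan_constant Gam (lifting_multiset S lift ++ enum B) eps /\
    epsH * epsA /
      (512%:R * (1 + #|S|%:R / #|B|%:R + #|B|%:R / #|S|%:R)) < eps.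
Proof.
have s0 : 0 < #|S|%:R :> R by rewrite ltr0n card_gt0.
have b0 : 0 < #|B|%:R :> R by rewrite ltr0n card_gt0.
have eH0 := kazhdan_gt0 hH; have eA0 := kazhdan_gt0 hAB.
have c1 : 1 <= 1 + #|S|%:R / #|B|%:R + #|B|%:R / #|S|%:R :> R.
  by rewrite -addrA lerDl addr_ge0 // divr_ge0 // ltW.
have c0 := lt_le_trans ltr01 c1.
(* The strict inequality is just 48 < 512. *)
exists (epsH * epsA / (48 * (1 + #|S|%:R / #|B|%:R + #|B|%:R / #|S|%:R))).
split; last first.
  rewrite ltr_pM2l ?mulr_gt0 // ltf_pV2 ?posrE ?mulr_gt0 ?ltr0n //.
  by rewrite ltr_pM2r // ltr_nat.
split.
- have [gH _ _] := hH; have [gA _ _] := hAB.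
  exact: (extension_generated hext hBA hlift gH gA).
- by rewrite divr_gt0 ?mulr_gt0.
rewrite le_min lee_fin; apply/andP; split.
  (* The cap 4 holds because [epsH * epsA] is at most 16 and the denominator at least 48. *)
  rewrite ler_pdivrMr ?mulr_gt0 //.
  have := kazhdan_le4 hH; have := kazhdan_le4 hAB; nra.
apply: le_ereal_inf_tmp => _ [rho rho0 ->]; apply: le_ereal_inf_tmp => _ [v /= vn0 <-].
rewrite lee_fin avg_displacementE -mulr_suml big_cat /= big_map !big_enum /=.
rewrite size_cat size_map -!cardE natrD.
have [z zP] := prim_root_exists_closed R[i] (cardG_gt0 A).
apply: avg_displacement_lower_bound => //.
- by rewrite usq_gt0.
- by apply: sumr_ge0 => s _; exact: usq_ge0.
- by apply: sumr_ge0 => s _; exact: usq_ge0.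
exact: (usq_le_displacements hA hext hSH hBA hlift hH hAB zP rho0).
Qed.
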